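(* Let $\theta\in(0,2\pi)$ and let $(\psi_n)_{n\ge 0}$ be the quantum walk on $\mathbb{Z}$ with homogeneous coin $C_x=e^{i\theta\sigma_1}$ for all $x\in\mathbb{Z}$ and initial state $\psi_0\in\ell^2(\mathbb{Z})\otimes\ell^2(\{\pm1\})$. Then for all $n\in\{0,1,2,\dots\}$, $x\in\mathbb{Z}$ and $z\in\{\pm1\}$, $$\psi_n(x,z)=e^{n\theta}\,\mathbb{E}\left[i^{S_n}\,\psi_0(X_n,Z_n)\ \middle|\ (S_0,Z_0,X_0)=(0,z,x)\right],$$ where $(S_n,Z_n,X_n)_{n\ge 0}$ is the Markov additive model driven by i.i.d. Poisson($\theta$) random variables defined in the context.
   Context: Quantum walk: identify $\ell^2(\mathbb{Z})\otimes\ell^2(\{\pm1\})$ with $\ell^2(\mathbb{Z}\times\{\pm1\})$ (complex-valued), with orthonormal basis $e_xe_z=e_x\otimes e_z$, and write $\psi=\sum_{x,z}\psi(x,z)e_xe_z$. Matrices on $\ell^2(\{\pm1\})$ are with respect to the ordered basis $(e_1,e_{-1})$. Given unitaries $C_x\in U(\ell^2(\{\pm1\}))$, $x\in\mathbb{Z}$, the coin operator is $C=\sum_{x}e_xe_x^*\otimes C_x$, the shift operator is $S e_xe_z=e_{x+z}e_z$, the walk operator is $W=SC$, and $\psi_n=W\psi_{n-1}$ for $n\ge1$. Here $\sigma_1=\begin{bmatrix}0&1\\1&0\end{bmatrix}$, so $e^{i\theta\sigma_1}=\begin{bmatrix}\cos\theta&i\sin\theta\\ i\sin\theta&\cos\theta\end{bmatrix}$.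 Markov additive model: let $N_1,N_2,\dots$ be i.i.d. Poisson random variables with parameter $\theta$. Set $S_0=0$ and $S_n=\sum_{j=1}^nN_j \pmod 4\in\{0,1,2,3\}$ for $n\ge1$; $Z_0=z$ and $Z_n=(-1)^{S_n}Z_0$; $X_0=x$ and $X_n=X_{n-1}-Z_{n-1}=X_0-\sum_{j=0}^{n-1}Z_j$ for $n\ge1$. *)

(* Defs.v *)
From HB Require Import structures.
From mathcomp Require Import all_boot all_order all_algebra.
From mathcomp Require Import all_classical all_reals all_analysis.
From mathcomp Require Import complex ring.

Set Implicit Arguments.
Unset Strict Implicit.
Unset Printing Implicit Defensive.

Import Order.TTheory GRing.Theory Num.Theory.
Import numFieldNormedType.Exports.

Local Open Scope classical_set_scope.
Local Open Scope ring_scope.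
Local Open Scope complex_scope.

(* The set {+1, -1} is encoded by 'I_2 with 0 for +1 and 1 for -1, so that
   2 x 2 matrices are written in the ordered basis (e_1, e_{-1}). *)
Definition spin := 'I_2.

Definition sgn (z : spin) : int := (-1) ^+ z.

(* The inverse of sgn; only used at the arguments 1 and -1. *)
Definition spin_of (m : int) : spin := if m == 1 then ord0 else ord_max.

Lemma sgnK : cancel sgn spin_of.
Proof. by case=> [[|[|//]] ltk2]; apply: val_inj. Qed.

Lemma spin_ofK (m : int) : m = 1 \/ m = -1 -> sgn (spin_of m) = m.
Proof. by case=> ->. Qed.

Section QuantumWalk.
Context {R : realType}.
Implicit Types (psi : int * spin -> R[i]) (C : int -> 'M[R[i]]_2).

Definition sqnorm psi : \bar R :=
  \esum_(p in [set: int * spin])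
    (complex.Re (psi p) ^+ 2 + complex.Im (psi p) ^+ 2)%:E.

Definition in_ell2 psi : Prop := (sqnorm psi < +oo)%E.

(* The basis vector e_x e_z. *)
Definition ket (x : int) (z : spin) : int * spin -> R[i] :=
  fun p => (p == (x, z))%:R.

(* The operators are given by their action on coordinates; their defining
   relations S e_x e_z = e_{x+z} e_z and C e_x e_z = e_x (x) C_x e_z are
   shift_op_ket and coin_op_ket, and both preserve the l^2 norm (for unitary
   C_x). *)
Definition shift_op psi : int * spin -> R[i] :=
  fun p => psi (p.1 - sgn p.2, p.2).

Definition coin_op C psi : int * spin -> R[i] :=
  fun p => \sum_(z : spin) C p.1 p.2 z * psi (p.1, z).

Definition walk_op C psi : int * spin -> R[i] := shift_op (coin_op C psi).

Lemma shift_op_ket x z : shift_op (ket x z) = ket (x + sgn z) z.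
Proof.
apply/funext => -[y w]; rewrite /shift_op /ket /= !xpair_eqE; congr (nat_of_bool _)%:R.
by case: (eqVneq w z) => [->|]; rewrite ?andbF // !andbT subr_eq.
Qed.

Lemma coin_op_ket C x z :
  coin_op C (ket x z) =
  fun p => \sum_(z' : spin) C x z' z * ket x z' p.
Proof.
apply/funext => -[y w]; rewrite /coin_op /ket /=.
under eq_bigr do rewrite xpair_eqE.
under [RHS]eq_bigr do rewrite xpair_eqE.
case: (eqVneq y x) => [->|_] /=; last by rewrite !big1 // => ? _; rewrite mulr0.
rewrite (bigD1 z) //= eqxx mulr1 big1 ?addr0; last first.
  by move=> i /negPf ->; rewrite mulr0.
rewrite (bigD1 w) //= eqxx mulr1 big1 ?addr0 //.
by move=> i; rewrite eq_sym => /negPf ->; rewrite mulr0.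
Qed.

Lemma sqnorm_shift_op psi : sqnorm (shift_op psi) = sqnorm psi.
Proof.
rewrite /sqnorm [RHS](reindex_esum [set: int * spin] _
  (fun p : int * spin => (p.1 - sgn p.2, p.2))) //.
split=> //.
  by move=> [x z] [y w] _ _ /= [+ zw]; rewrite zw => /addIr ->.
by move=> [x z] _; exists (x + sgn z, z); rewrite //= addrK.
Qed.

Lemma sqr_mod (a : R[i]) :
  (complex.Re a ^+ 2 + complex.Im a ^+ 2)%:C = a * Num.conj a.
Proof. by rewrite -sqr_normc normc_def /= -rmorphXn sqr_sqrtr // addr_ge0 ?sqr_ge0. Qed.

Lemma sqnorm_coin_op C psi :
  (forall x, C x \is unitarymx) -> sqnorm (coin_op C psi) = sqnorm psi.
Proof.
move=> unitC.
have sqnormE phi : sqnorm phi = \esum_(x in [set: int])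
  (\sum_(z : spin) (complex.Re (phi (x, z)) ^+ 2 + complex.Im (phi (x, z)) ^+ 2))%:E.
  rewrite /sqnorm.
  pose a x z := (complex.Re (phi (x, z)) ^+ 2 + complex.Im (phi (x, z)) ^+ 2)%:E.
  have a0 x z : (0 <= a x z)%E by rewrite lee_fin addr_ge0 ?sqr_ge0.
  transitivity (\esum_(x in [set: int]) \esum_(z in [set: spin]) a x z).
    rewrite esum_esum // [LHS](_ : _ = \esum_(k in [set: int] `*`` (fun=> [set: spin])) a k.1 k.2) //.
    by congr esum; [apply/seteqP; split | apply/funext => -[]].
  apply: eq_esum => x _; rewrite esum_fset //; last exact: finite_finset.
  rewrite -sumEFin (fsbigE (enum 'I_2)) ?enum_uniq //; last first.
    by move=> z _; rewrite mem_enum.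
  by rewrite big_enum_cond; apply: eq_bigl => z; rewrite in_setT.
rewrite !sqnormE; apply: eq_esum => x _; congr EFin.
apply: (@complexI R); rewrite !rmorph_sum /=.
under eq_bigr do rewrite sqr_mod.
under [RHS]eq_bigr do rewrite sqr_mod.
pose v : 'cV[R[i]]_2 := \col_z psi (x, z).
have H (u : 'cV[R[i]]_2) : \sum_z u z 0 * Num.conj (u z 0) = (u^T *m map_mx Num.conj u) 0 0.
  by rewrite mxE; apply: eq_bigr => z _; rewrite !mxE.
transitivity (\sum_z v z 0 * Num.conj (v z 0)); last by apply: eq_bigr => z _; rewrite mxE.
transitivity (\sum_z (C x *m v) z 0 * Num.conj ((C x *m v) z 0)).
  apply: eq_bigr => z _; rewrite mxE; congr (_ * Num.conj _);
  by apply: eq_bigr => w _; rewrite mxE.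
rewrite !H trmx_mul map_mxM mulmxA -(mulmxA v^T).
have /unitarymxP : (C x)^T \is unitarymx by rewrite trmx_unitary.
by rewrite trmxK => ->; rewrite mulmx1.
Qed.

Lemma in_ell2_walk_op C psi :
  (forall x, C x \is unitarymx) -> in_ell2 psi -> in_ell2 (walk_op C psi).
Proof. by move=> unitC; rewrite /in_ell2 sqnorm_shift_op sqnorm_coin_op. Qed.

Definition expmx n (A : 'M[R[i]]_n.+1) : 'M[R[i]]_n.+1 :=
  limn (series (fun k => (k`!%:R)^-1 *: A ^+ k)).

Definition sigma1 : 'M[R[i]]_2 := \matrix_(i, j) (i != j)%:R.

Definition coin (theta : R) : 'M[R[i]]_2 := expmx (('i%C * theta%:C) *: sigma1).

Lemma cvg_real_complex (u : R^nat) (l : R) :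
  u @ \oo --> l ->
  ((fun n => (u n)%:C) : nat -> (R[i] : numFieldType)) @ \oo -->
    (l%:C : (R[i] : numFieldType)).
Proof.
move=> /cvgrPdist_lt ul; apply/cvgrPdist_lt => -[e f]; rewrite ltcE /= => /andP[/eqP f0 e0].
have {ul} := ul e e0; apply: filterS => n.
by rewrite -rmorphB normc_def /= expr0n addr0 sqrtr_sqr f0 ltcR.
Qed.

Lemma sigma1_sqr : (sigma1 : 'M[R[i]]_2) ^+ 2 = 1.
Proof.
apply/matrixP => i j; rewrite expr2 !mxE !big_ord_recl big_ord0 !mxE.
by case: i => [[|[|//]] ?]; case: j => [[|[|//]] ?]; rewrite /= ?(mul0r, mulr0, mul1r, mulr1, addr0, add0r).
Qed.

Lemma sigma1X k : (sigma1 : 'M[R[i]]_2) ^+ k = if odd k then sigma1 else 1.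
Proof. by rewrite -{1}(odd_double_half k) exprD -mul2n exprM sigma1_sqr expr1n mulr1; case: odd. Qed.

Lemma coinE (theta : R) :
  coin theta = \matrix_(i, j)
    if i == j then (cos theta)%:C else 'i%C * (sin theta)%:C.
Proof.
rewrite /coin /expmx.
have H : series (fun k => (k`!%:R)^-1 *: (('i%C * theta%:C) *: (sigma1 : 'M[R[i]]_2)) ^+ k) =
  fun n => ((series (cos_coeff theta) n)%:C : R[i]) *: (1 : 'M[R[i]]_2)
           + (('i%C * (series (sin_coeff theta) n)%:C) : R[i]) *: (sigma1 : 'M[R[i]]_2).
  apply/funext => n; rewrite /series /=.
  elim: n => [|n IH]; first by rewrite !big_nil /= mulr0 !scale0r addr0.
  rewrite !big_nat_recr //= {}IH exprZn sigma1X scalerA.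
  have fE : (n`!%:R)^-1 = ((n`!%:R)^-1 : R)%:C :> R[i] by rewrite rmorphV ?unitfE ?pnatr_eq0 -?lt0n ?fact_gt0 //= rmorph_nat.
  have iE : 'i%C ^+ n = ((-1) ^+ n./2)%:C * 'i%C ^+ odd n :> R[i].
    by rewrite -{1}(odd_double_half n) exprD -mul2n exprM sqr_i rmorphXn rmorphN1 mulrC.
  rewrite /cos_coeff /sin_coeff /= exprMn -rmorphXn fE iE.
  have he : odd n -> n.-1./2 = n./2 by case: (n) => //= m; rewrite uphalf_half => /negPf ->.
  case: (boolP (odd n)) he => [on /(_ isT) he | on _] /=; rewrite -?exprnP ?he.
    rewrite !mul0r addr0 -addrA -scalerDl mul1r !expr1.
    congr (_ + _ *: _); rewrite rmorphD mulrDr; congr (_ + _).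
    by rewrite !rmorphM /=; ring.
  rewrite !mul0r addr0 mul1r addrAC -scalerDl.
  congr (_ *: _ + _); rewrite expr0 mulr1 rmorphD; congr (_ + _).
  by rewrite !rmorphM /=; ring.
rewrite H.
have -> : \matrix_(i, j) (if i == j then (cos theta)%:C else 'i%C * (sin theta)%:C) =
  ((cos theta)%:C : R[i]) *: (1 : 'M[R[i]]_2) + (('i%C * (sin theta)%:C) : R[i]) *: (sigma1 : 'M[R[i]]_2).
  apply/matrixP => i j; rewrite !mxE.
  by case: eqP => _; rewrite /= ?mulr1 ?mulr0 ?addr0 ?add0r.
apply: (@cvg_lim ('M[(R[i] : numFieldType)]_2 : normedModType _)); first exact: norm_hausdorff.
apply: cvgD; apply: cvgZr_tmp.
  by apply: cvg_real_complex; rewrite unlock; exact: is_cvg_series_cos_coeff.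
by apply: cvgMl_tmp; apply: cvg_real_complex; rewrite unlock; exact: is_cvg_series_sin_coeff.
Qed.

Lemma coin_unitary (theta : R) : coin theta \is unitarymx.
Proof.
apply/unitarymxP/matrixP => i j; rewrite coinE !mxE !big_ord_recl big_ord0 !mxE.
have cs := cos2Dsin2 theta.
case: i => [[|[|//]] ?]; case: j => [[|[|//]] ?] /=;
  apply/eqP; rewrite eq_complex /= ?(mulr0, mul0r, mul1r, mulr1, addr0, add0r).
all: by apply/andP; split; apply/eqP; (ring || (rewrite -cs; ring)).
Qed.

End QuantumWalk.

Section Probability.
Context {R : realType} {d : measure_display} {T : measurableType d}.
Variable P : probability T R.

Definition mutually_independent d' (U : measurableType d')
    (N : nat -> {RV P >-> U}) : Prop :=
  forall (J : seq nat) (A : nat -> set U), uniq J ->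
    (forall j, measurable (A j)) ->
    P (\bigcap_(j in [set` J]) (N j @^-1` A j)) =
    (\prod_(j <- J) P (N j @^-1` A j))%E.

(* The law of a nat-valued random variable is determined by its mass
   function. *)
Definition poisson_distributed (rate : R) (N : {RV P >-> nat}) : Prop :=
  forall k : nat, distribution P N [set k] = (poisson_pmf rate k)%:E.

(* E[f | A] for an event A with P A > 0 and a complex-valued f. *)
Definition cond_expectation (f : T -> R[i]) (A : set T) : R[i] :=
  ((fine (P A))^-1)%:C *
  ((\int[P]_(w in A) complex.Re (f w)) +i* (\int[P]_(w in A) complex.Im (f w))).

End Probability.

Section MarkovAdditive.
Context {R : realType} {d : measure_display} {T : measurableType d}.
Context {P : probability T R}.
(* N j is the variable N_{j+1} of the sequence N_1, N_2, ... *)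
Variable N : nat -> {RV P >-> nat}.

Definition S_ (n : nat) (w : T) : nat := ((\sum_(j < n) N j w) %% 4)%N.

Definition Z_ (z : int) (n : nat) (w : T) : int := (-1) ^+ S_ n w * z.

Definition X_ (z x : int) (n : nat) (w : T) : int :=
  x - \sum_(j < n) Z_ z j w.

End MarkovAdditive.

(* Main.v *)
Require Import Defs.
From mathcomp Require Import all_boot all_order all_algebra.
From mathcomp Require Import all_classical all_reals all_analysis.
From mathcomp Require Import complex ring.
Set Implicit Arguments.
Unset Strict Implicit.
Unset Printing Implicit Defensive.
Import Order.TTheory GRing.Theory Num.Theory.
Import numFieldNormedType.Exports.
Local Open Scope classical_set_scope.
Local Open Scope ring_scope.
Local Open Scope complex_scope.

(** The Poisson weights are, up to the factor e^-theta, the coefficients of the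
    exponential series, so averaging i^N a(N mod 2) over a Poisson variable N
    gives e^-theta times
      sum_k (i theta)^k / k! a(k mod 2)
        = cos theta a(0) + i sin theta a(1).
    The right-hand side is the action of the coin e^(i theta sigma_1), where
    the parity of N decides whether the spin flips. Hence one step of the
    Markov additive model, weighted by i^N, is on average e^-theta times one
    application of the walk operator W (walk_op_poisson).

    To iterate this, let u_n(phi)(x, z) be the expectation of
    i^(S_n) phi(X_n, Z_n) for the model started at (0, z, x). Given the first n
    increments, the (n+1)-st is an independent Poisson variable; averaging over
    it alone gives u_(n+1)(phi) = e^-theta u_n(W phi)
    (expectation_amplitude_step). By induction u_n(phi) = e^(-n theta) W^n phi.

    Only residues mod 4 of the increments enter, so the first n of them may be
    replaced by a random variable with values in a finite type. Every
    expectation is then a finite sum, and conditioning on the past is an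
    exchange of finite sums (cond_expectation_freeze). *)

(** * Random variables with finitely many values *)

Section FiniteRange.
Context {R : realType} {d : measure_display} {T : measurableType d}.
Context {P : probability T R}.

Lemma Rintegral_finite_range (F : finType) (H : T -> F) (g : F -> R) :
  (forall s, measurable (H @^-1` [set s])) ->
  \int[P]_w g (H w) = \sum_s fine (P (H @^-1` [set s])) * g s.
Proof.
move=> mH; rewrite /Rintegral.
have ind s : P.-integrable setT (fun w => (\1_(H @^-1` [set s]) w)%:E).
  exact: integrable_indic.
under eq_integral => w _.
  have -> : (g (H w))%:E = (\sum_s (g s)%:E * (\1_(H @^-1` [set s]) w)%:E)%E.
    rewrite (bigD1 (H w)) //= big1 ?adde0 => [|s sH].
      by rewrite indicE mem_set // mule1.
    rewrite indicE memNset ?mule0 //= => Hs.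
    by rewrite -Hs eqxx in sH.
  over.
rewrite integral_sum //; last by move=> s; exact: integrableZl.
transitivity (fine (\sum_s (fine (P (H @^-1` [set s])) * g s)%:E));
  last by rewrite sumEFin.
congr fine; apply: eq_bigr => s _.
rewrite integralZl // integral_indic // setIT EFinM fineK ?fin_num_measure //.
by rewrite muleC.
Qed.

Lemma cond_expectation_finite_range (F : finType) (H : T -> F) (g : F -> R[i]) :
  (forall s, measurable (H @^-1` [set s])) ->
  cond_expectation P (fun w => g (H w)) setT =
  \sum_s (fine (P (H @^-1` [set s])))%:C * g s.
Proof.
move=> mH; rewrite /cond_expectation probability_setT invr1 mul1r.
rewrite (Rintegral_finite_range (fun s => complex.Re (g s))) //.
rewrite (Rintegral_finite_range (fun s => complex.Im (g s))) //.
apply/eqP; rewrite eq_complex /= !raddf_sum /=; apply/andP; split; apply/eqP;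
  apply: eq_bigr => s _; case: (g s) => a b /=; ring.
Qed.

(** Averaging out [K] with [H] frozen: since [K] is independent of [H], its law
    given [H] is its unconditional law. *)
Lemma cond_expectation_freeze (F G : finType) (H : T -> F) (K : T -> G)
    (u : F -> G -> R[i]) :
  (forall s, measurable (H @^-1` [set s])) ->
  (forall t, measurable (K @^-1` [set t])) ->
  (forall s t, P (H @^-1` [set s] `&` K @^-1` [set t]) =
     (P (H @^-1` [set s]) * P (K @^-1` [set t]))%E) ->
  cond_expectation P (fun w => u (H w) (K w)) setT =
  cond_expectation P (fun w =>
    \sum_t (fine (P (K @^-1` [set t])))%:C * u (H w) t) setT.
Proof.
move=> mH mK HK.
have pre s t : (fun w => (H w, K w)) @^-1` [set (s, t)] =
               H @^-1` [set s] `&` K @^-1` [set t].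
  by apply/seteqP; split => w /= [-> ->].
rewrite (cond_expectation_finite_range (H := fun w => (H w, K w))
  (fun p => u p.1 p.2)); last first.
  by move=> -[s t]; rewrite pre; exact: measurableI.
rewrite (cond_expectation_finite_range
  (fun s => \sum_t (fine (P (K @^-1` [set t])))%:C * u s t)) //.
under [RHS]eq_bigr do rewrite mulr_sumr.
rewrite pair_big; apply: eq_bigr => -[s t] _ /=.
by rewrite pre HK fineM ?fin_num_measure // rmorphM mulrA.
Qed.

End FiniteRange.

Lemma factor_through (T F : Type) (V : Type) (v0 : V) (H : T -> F) (f : T -> V) :
  (forall w w', H w = H w' -> f w = f w') -> exists g, f = g \o H.
Proof.
move=> Hf; exists (fun s => if pselect (exists w, H w = s) is left e
                            then f (projT1 (cid e)) else v0).
apply/funext => w /=; case: pselect => [e|[]]; last by exists w.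
by case: (cid e) => w' /= /Hf.
Qed.

(** * A Poisson variable modulo 4 *)

(** The trigonometric signs are the real and imaginary parts of i^k, read off
    [k] mod 4: [r = 0] gives the cosine coefficients, [r = 1] the sine ones. *)
Lemma indic_residue_difference (R : realType) r k : (r < 2)%N ->
  \1_[set k | k %% 4 = r]%N k - \1_[set k | k %% 4 = r.+2]%N k =
  (odd k == odd r)%:R * (-1) ^+ k./2 :> R.
Proof.
move=> r2; rewrite !indicE.
have memE s : (k \in [set k | k %% 4 = s]%N) = (k %% 4 == s)%N.
  by apply/idP/eqP => [|ks]; rewrite inE.
rewrite !memE [in odd k](divn_eq k 4) [in k./2](divn_eq k 4).
have -> : (k %/ 4 * 4 = (k %/ 4 * 2).*2)%N by rewrite -muln2 -mulnA.
have : (k %% 4 < 4)%N by rewrite ltn_mod.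
rewrite oddD halfD odd_double doubleK addFb add0n exprD mulnC exprM sqrrN !expr1n.
rewrite mul1r.
by case: (_ %% _)%N r r2 => [|[|[|[|]]]] [|[|]] //= _ _;
  rewrite ?(subr0, sub0r, mul1r, mul0r).
Qed.

Section PoissonResidues.
Context {R : realType} {d : measure_display} {T : measurableType d}.
Context {P : probability T R} {theta : R} {N : {RV P >-> nat}}.
Hypothesis theta_gt0 : 0 < theta.
Hypothesis N_poisson : poisson_distributed theta N.

Lemma measurable_preimage_nat (M : {RV P >-> nat}) (A : set nat) :
  measurable (M @^-1` A).
Proof. by rewrite -[X in measurable X]setTI; exact: measurable_funP. Qed.

(** Sigma-additivity over the fibres of [N]. It is stated as convergence of real
    partial sums so that two such series can be subtracted termwise. *)
Lemma cvg_poisson_probability (A : set nat) :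
  series (fun k => poisson_pmf theta k * \1_A k) @ \oo -->
  fine (P (N @^-1` A)).
Proof.
pose F k := N @^-1` ([set k] `&` A).
have PF k : P (F k) = (poisson_pmf theta k * \1_A k)%:E.
  rewrite indicE; case: (pselect (A k)) => Ak.
    rewrite mem_set // mulr1 -N_poisson /F.
    by congr (P (_ @^-1` _)); apply/setIidPl => _ ->.
  rewrite memNset // mulr0 /F (_ : _ `&` _ = set0) ?measure0 //.
  by apply/seteqP; split => // j [->].
have UF : \bigcup_k F k = N @^-1` A.
  apply/seteqP; split => [w [k _ []] //|w /= Aw].
  by exists (N w).
suff cvgP : (EFin \o series (fun k => poisson_pmf theta k * \1_A k)) @ \oo -->
    P (N @^-1` A).
  apply: (@fine_cvg _ _ _ _ (EFin \o _)).
  by rewrite fineK ?fin_num_measure //; exact: measurable_preimage_nat.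
rewrite -UF.
have -> : EFin \o series (fun k => poisson_pmf theta k * \1_A k) =
          (fun n => \sum_(0 <= k < n) P (F k))%E.
  by apply/funext => n; rewrite /= -sumEFin; apply: eq_bigr => k _; rewrite PF.
apply: measure_semi_sigma_additive.
- by move=> k; exact: measurable_preimage_nat.
- by move=> i j _ _ [w [[<- _] [<- _]]].
- by rewrite UF; exact: measurable_preimage_nat.
Qed.

(** Opposite residues carry opposite powers of i, so only these two differences
    matter; subtracting the series of their probabilities leaves the cosine and
    sine series. *)
Lemma poisson_residue_difference r : (r < 2)%N ->
  fine (P (N @^-1` [set k | k %% 4 = r]%N)) -
  fine (P (N @^-1` [set k | k %% 4 = r.+2]%N)) =
  expR (- theta) * (if r == 0%N then cos theta else sin theta).
Proof.
move=> r2.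
have cs : series (if r == 0%N then cos_coeff theta else sin_coeff theta) @ \oo
    --> (if r == 0%N then cos theta else sin theta).
  by rewrite unlock unlock; case: ifP => _; [exact: is_cvg_series_cos_coeff|
     exact: is_cvg_series_sin_coeff].
have /(_ _) L := cvgB (cvg_poisson_probability (A := [set k | k %% 4 = r]%N))
   (cvg_poisson_probability (A := [set k | k %% 4 = r.+2]%N)).
rewrite -(cvg_lim (@Rhausdorff R) L); apply: cvg_lim; first exact: Rhausdorff.
rewrite [X in X @ _](_ : _ = fun n => expR (- theta) *
    series (if r == 0%N then cos_coeff theta else sin_coeff theta) n).
  exact: cvgMl_tmp cs.
apply/funext => n; rewrite fctE /series /= mulr_sumr.
rewrite -sumrB; apply: eq_bigr => k _.
rewrite -mulrBr indic_residue_difference // /poisson_pmf theta_gt0.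
case: r r2 {cs L} => [|[|//]] _; rewrite /cos_coeff /sin_coeff /=.
  rewrite -exprnP eqbF_neg; ring.
rewrite eqb_id.
case: k => [|k]; first by rewrite /= !mul0r !mulr0.
by rewrite /= uphalf_half; case: (odd k) => /=; rewrite ?add0n; ring.
Qed.

End PoissonResidues.

(** * The past of the Markov additive model *)

Section Model.
Context {R : realType} {d : measure_display} {T : measurableType d}.
Context {P : probability T R}.
Variable N : nat -> {RV P >-> nat}.
Hypothesis N_indep : mutually_independent N.

Definition residue (k : nat) : 'I_4 := inZp k.

Definition past n w : {ffun 'I_n -> 'I_4} := [ffun j => residue (N (val j) w)].

(** For [j >= n] the coordinate set is the fibre of [t]: extending the cylinder
    over [n] coordinates by one more then imposes residue [t] on the increment
    [N n]. *)
Definition cylinder n (s : {ffun 'I_n -> 'I_4}) (t : 'I_4) (j : nat) : set nat :=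
  residue @^-1` [set (if insub j is Some i then s i else t)].

Lemma past_preimage n s t : past n @^-1` [set s] =
  \bigcap_(j in [set` index_iota 0 n]) (N j @^-1` cylinder s t j).
Proof.
apply/seteqP; split=> [w /= <- j /=|w /= ws].
  rewrite mem_index_iota => jn.
  by rewrite /cylinder /= insubT /past ffunE.
apply/ffunP => i; rewrite ffunE.
have := ws (val i); rewrite /= mem_index_iota ltn_ord => /(_ isT).
by rewrite /cylinder /= valK.
Qed.

Lemma measurable_past n s : measurable (past n @^-1` [set s]).
Proof.
rewrite (past_preimage _ ord0); apply: fin_bigcap_measurable => // j _.
exact: measurable_preimage_nat.
Qed.

Lemma past_indep n s t :
  P (past n @^-1` [set s] `&` (residue \o N n) @^-1` [set t]) =
  (P (past n @^-1` [set s]) * P ((residue \o N n) @^-1` [set t]))%E.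
Proof.
have cn : N n @^-1` cylinder s t n = (residue \o N n) @^-1` [set t].
  by rewrite /cylinder insubF ?ltnn.
rewrite (past_preimage _ t) N_indep ?iota_uniq // -cn.
rewrite -(big_nat_recr n 0 (fun j => P (N j @^-1` cylinder s t j))) //=.
rewrite -N_indep ?iota_uniq //; congr (P _).
apply/seteqP; split=> [w [/= h hn] j|w h].
  rewrite /= mem_index_iota /= ltnS leq_eqVlt => /orP[/eqP -> //|jn].
  by apply: h; rewrite /= mem_index_iota.
split=> [j|]; last by apply: h; rewrite /= mem_index_iota /=.
rewrite /= mem_index_iota /= => jn; apply: h.
by rewrite /= mem_index_iota ltnS; exact: ltnW.
Qed.

Lemma S_recr n w : S_ N n.+1 w = ((S_ N n w + N n w) %% 4)%N.
Proof. by rewrite /S_ big_ord_recr /= modnDml. Qed.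

Lemma X_recr z x n w : X_ N z x n.+1 w = X_ N z x n w - Z_ N z n w.
Proof. by rewrite /X_ big_ord_recr /= opprD addrA. Qed.

Lemma Z_recr z n w : Z_ N z n.+1 w = (-1) ^+ residue (N n w) * Z_ N z n w.
Proof.
have m1_4 : (-1) ^+ 4 = 1 :> int by [].
rewrite /Z_ S_recr /= !(expr_mod (_ + _) m1_4, expr_mod (N n w) m1_4) exprD.
by rewrite -mulrA mulrCA.
Qed.

Lemma S_eq_past n w w' m : past n w = past n w' -> (m <= n)%N ->
  S_ N m w = S_ N m w'.
Proof.
move=> ww'; elim: m => [|m IH] mn; first by rewrite /S_ !big_ord0.
rewrite !S_recr IH; last exact: ltnW.
rewrite -modnDmr -[RHS]modnDmr; congr ((_ + _) %% 4)%N.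
by have /ffunP/(_ (Ordinal mn)) := ww'; rewrite !ffunE => /(congr1 val).
Qed.

(** Through this factorization, expectations of functions of the state become
    finite sums over the residues, to which independence applies. *)
Lemma state_factors_past z x n : exists g,
  (fun w => (S_ N n w, Z_ N z n w, X_ N z x n w)) = g \o past n.
Proof.
apply: (factor_through (0%N, 0, 0)) => w w' ww'.
have Zww' m : (m <= n)%N -> Z_ N z m w = Z_ N z m w'.
  by move=> mn; rewrite /Z_ (S_eq_past ww' mn).
rewrite (S_eq_past ww') // Zww' //; congr (_, _).
by rewrite /X_; congr (_ - _); apply: eq_bigr => j _; apply: Zww'; exact: ltnW.
Qed.

(** * One step of the walk *)

Variable theta : R.
Hypothesis theta_gt0 : 0 < theta.
Hypothesis N_poisson : forall j, poisson_distributed theta (N j).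
Implicit Types (phi : int * spin -> R[i]).

(** The residues 0 and 2 both keep the spin but with weights 1 and -1, and the
    residues 1 and 3 both flip it with weights i and -i, which leaves the
    entries cos theta and i sin theta of the coin. *)
Lemma walk_op_poisson phi n (x : int) (z : spin) :
  \sum_(t : 'I_4) (fine (P ((residue \o N n) @^-1` [set t])))%:C *
    ('i%C ^+ t * phi (x - sgn z, spin_of ((-1) ^+ t * sgn z))) =
  (expR (- theta))%:C * walk_op (fun _ => coin theta) phi (x, z).
Proof.
pose q r := fine (P (N n @^-1` [set k | k %% 4 = r]%N)).
have qE (t : 'I_4) : fine (P ((residue \o N n) @^-1` [set t])) = q t.
  congr (fine (P _)); apply/seteqP; split=> w /=; first by move=> <-.
  by move=> h; apply: val_inj.
have q0 : q 0%N = expR (- theta) * cos theta + q 2%N.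
  by rewrite -(poisson_residue_difference theta_gt0 (N_poisson n) (r := 0%N)) // subrK.
have q1 : q 1%N = expR (- theta) * sin theta + q 3%N.
  by rewrite -(poisson_residue_difference theta_gt0 (N_poisson n) (r := 1%N)) // subrK.
have i3 : 'i%C ^+ 3 = - 'i%C :> R[i] by rewrite exprS sqr_i mulrN1.
have spinE k : spin_of ((-1) ^+ k * sgn z) = if odd k == odd z then ord0 else ord_max.
  rewrite -signr_odd /sgn.
  by case: z => [[|[|//]] ?]; case: (odd k).
under eq_bigr do rewrite qE spinE.
rewrite /walk_op /shift_op /coin_op /= coinE !big_ord_recr !big_ord0 /=.
have -> : widen_ord (leqnSn 1) ord_max = ord0 by apply: val_inj.
rewrite !mxE q0 q1 sqr_i i3 !rmorphD !rmorphM /=.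
by case: z {spinE} => [[|[|//]] z2] /=; ring.
Qed.

Definition amplitude phi (z x : int) n w : R[i] :=
  'i%C ^+ S_ N n w * phi (X_ N z x n w, spin_of (Z_ N z n w)).

(** The last increment is averaged out conditionally on the first [n]; it acts
    on the state (S_n, Z_n, X_n) as one step of the walk does. *)
Lemma expectation_amplitude_step phi (z : spin) x n :
  cond_expectation P (amplitude phi (sgn z) x n.+1) setT =
  (expR (- theta))%:C * cond_expectation P
    (amplitude (walk_op (fun _ => coin theta) phi) (sgn z) x n) setT.
Proof.
have [g gE] := state_factors_past (sgn z) x n.
pose v phi (y : nat * int * int) : R[i] := 'i%C ^+ y.1.1 * phi (y.2, spin_of y.1.2).
have amplitudeE phi' w : amplitude phi' (sgn z) x n w = v phi' (g (past n w)).
  by have /(congr1 (@^~ w)) /= <- := gE.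
pose u s (t : 'I_4) : R[i] :=
  let: (k, c, y) := g s in
  'i%C ^+ k * ('i%C ^+ t * phi (y - c, spin_of ((-1) ^+ t * c))).
have uE w t : u (past n w) t = 'i%C ^+ S_ N n w * ('i%C ^+ t *
    phi (X_ N (sgn z) x n w - Z_ N (sgn z) n w,
         spin_of ((-1) ^+ t * Z_ N (sgn z) n w))).
  by rewrite /u; have /(congr1 (@^~ w)) /= <- := gE.
have i4 : 'i%C ^+ 4 = 1 :> R[i] by rewrite (exprM _ 2 2) sqr_i sqrrN expr1n.
have -> : amplitude phi (sgn z) x n.+1 =
          (fun w => u (past n w) (residue (N n w))).
  apply/funext => w; rewrite uE /amplitude X_recr Z_recr S_recr.
  by rewrite /= !(expr_mod (_ + _) i4, expr_mod (N n w) i4) exprD mulrA.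
rewrite (cond_expectation_freeze (K := residue \o N n)); first last.
- exact: past_indep.
- move=> t; exact: (measurable_preimage_nat (N n) (residue @^-1` [set t])).
- exact: measurable_past.
have -> : (fun w => \sum_t (fine (P ((residue \o N n) @^-1` [set t])))%:C *
                 u (past n w) t) =
  (fun w => (expR (- theta))%:C *
     v (walk_op (fun _ => coin theta) phi) (g (past n w))).
  apply/funext => w; rewrite -amplitudeE /amplitude.
  have Zs : sgn (spin_of (Z_ N (sgn z) n w)) = Z_ N (sgn z) n w.
    apply: spin_ofK; rewrite /Z_ /sgn -exprD -signr_odd.
    by case: odd; [right|left].
  rewrite mulrCA -(walk_op_poisson _ n) mulr_sumr; apply: eq_bigr => t _.
  by rewrite uE Zs mulrCA.
rewrite (funext (amplitudeE _)).
rewrite (cond_expectation_finite_range (fun s => _ * v _ (g s)));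
  last exact: measurable_past.
rewrite (cond_expectation_finite_range (fun s => v _ (g s)));
  last exact: measurable_past.
by rewrite mulr_sumr; apply: eq_bigr => s _; rewrite mulrCA.
Qed.

End Model.

Theorem theorem2p7 (R : realType) (d : measure_display)
  (Omega : measurableType d) (P : probability Omega R)
  (theta : R) (htheta : 0 < theta < 2 * pi)
  (N : nat -> {RV P >-> nat})
  (hNindep : mutually_independent N)
  (hNpoisson : forall j : nat, poisson_distributed theta (N j))
  (psi : nat -> int * spin -> R[i])
  (hpsi0 : in_ell2 (psi 0%N))
  (hpsi : forall n : nat, psi n.+1 = walk_op (fun _ => coin theta) (psi n)) :
  forall (n : nat) (x : int) (z : spin),
    psi n (x, z) =
    (expR (n%:R * theta))%:C *
    cond_expectation P
      (fun w => 'i%C ^+ S_ N n w *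
         psi 0%N (X_ N (sgn z) x n w, spin_of (Z_ N (sgn z) n w)))
      [set w | (S_ N 0 w, Z_ N (sgn z) 0 w, X_ N (sgn z) x 0 w)
               = (0%N, sgn z, x)].
Proof.
move=> n x z; have /andP[theta_gt0 _] := htheta.
have S0 w : S_ N 0 w = 0%N by rewrite /S_ big_ord0.
have Z0 w : Z_ N (sgn z) 0 w = sgn z by rewrite /Z_ S0 mul1r.
have X0 w : X_ N (sgn z) x 0 w = x by rewrite /X_ big_ord0 subr0.
(* The starting state is deterministic, so the conditioning event is sure. *)
have -> : [set w | (S_ N 0 w, Z_ N (sgn z) 0 w, X_ N (sgn z) x 0 w)
                   = (0%N, sgn z, x)] = setT.
  by apply/seteqP; split=> // w _; rewrite /= S0 Z0 X0.
(* Starting from an arbitrary time [m] lets the induction on [n] peel off the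
   last step of the model together with the first step of the walk. *)
suff shift m : psi (m + n)%N (x, z) = (expR (n%:R * theta))%:C *
    cond_expectation P (amplitude N (psi m) (sgn z) x n) setT by exact: shift 0%N.
elim: n m => [|n IH] m.
  rewrite addn0 mul0r expR0 mul1r.
  have -> : amplitude N (psi m) (sgn z) x 0 = (fun w => cst (psi m (x, z)) tt).
    by apply/funext => w; rewrite /amplitude S0 Z0 X0 expr0 mul1r sgnK.
  have preT : (fun _ : Omega => tt) @^-1` [set tt] = setT.
    by apply/seteqP; split.
  rewrite (cond_expectation_finite_range (H := fun=> tt)).
    rewrite (big_pred1 tt) => [|[]//].
    by rewrite preT probability_setT mul1r.
  by case; rewrite preT.
rewrite addnS -addSn IH hpsi (expectation_amplitude_step hNindep theta_gt0 hNpoisson).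
by rewrite mulrA -rmorphM -expRD -natr1 mulrDl mul1r addrK.
Qed.
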